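(* Let $\mathscr{A},\mathscr{B}$ be two $C^*$-algebras. If $\Phi:\mathscr{A}\to\mathscr{B}$ is a continuous (not necessarily linear) map in the class $S^{(2)}_{\mathrm{mon}+}$, then the following statements are equivalent: (1) $\Phi(0)=0$; (2) $\Phi(\alpha A)\leq\alpha\Phi(A)$ for every $\alpha\in(0,1]$ and every $A\in\mathscr{A}_+$; (3) $\Phi(\alpha A)\geq\alpha\Phi(A)$ for every $\alpha\in[1,\infty)$ and every $A\in\mathscr{A}_+$.
   Context: Maps between $C^*$-algebras are arbitrary functions; linearity is not assumed. $\mathscr{A}_+$ is the set of positive elements of $\mathscr{A}$, and $\leq$ is the usual order on self-adjoint elements. A map is positive if it sends positive elements to positive elements. For a map $\Phi:\mathscr{A}\to\mathscr{B}$ let $\Phi_n:M_n(\mathscr{A})\to M_n(\mathscr{B})$, $\Phi_n([a_{ij}])=[\Phi(a_{ij})]$, be the entrywise map. A positive map $\Phi$ is in the class $S^{(n)}_{\mathrm{mon}+}$ if $\Phi_n$ is monotone on positive elements of $M_n(\mathscr{A})$, i.e. $\Phi_n(X)\geq\Phi_n(Y)$ whenever $X\geq Y\geq 0$ in $M_n(\mathscr{A})$. Continuity is with respect to the norm topologies. *)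

(* Defs.v *)
From HB Require Import structures.
From mathcomp Require Import all_boot all_order all_algebra.
From mathcomp Require Import complex.
From mathcomp Require Import all_classical all_reals all_analysis.

Set Implicit Arguments.
Unset Strict Implicit.
Unset Printing Implicit Defensive.

Import Order.TTheory GRing.Theory Num.Theory.
Import numFieldNormedType.Exports.

Local Open Scope ring_scope.
Local Open Scope complex_scope.

(* Rings with involution.  No unit is required, so the ring structures of
   ssralg, which all have a unit, do not apply. *)
HB.mixin Record Zmodule_isStarRing A of GRing.Zmodule A := {
  smul : A -> A -> A;
  star : A -> A;
  smulA : associative smul;
  smulDl : left_distributive smul +%R;
  smulDr : right_distributive smul +%R;
  starK : involutive star;
  starD : {morph star : x y / x + y};
  starM : forall x y, star (smul x y) = smul (star y) (star x)
}.

#[short(type="starRingType")]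
HB.structure Definition StarRing :=
  {A of Zmodule_isStarRing A & GRing.Zmodule A}.

(* The norm of a normed module over R[i] takes its values in R[i]; it is
   nonnegative there, hence real. *)
HB.mixin Record StarRing_isCstarAlgebra (R : realType) A
    of CompleteNormedModule R[i] A & StarRing A := {
  scale_smull : forall (k : R[i]) (x y : A), smul (k *: x) y = k *: smul x y;
  scale_smulr : forall (k : R[i]) (x y : A), smul x (k *: y) = k *: smul x y;
  starZ : forall (k : R[i]) (x : A), star (k *: x) = k^* *: star x;
  normr_smul_le : forall x y : A, `|smul x y| <= `|x| * `|y|;
  cstar_identity : forall x : A, `|smul (star x) x| = `|x| ^+ 2
}.

#[short(type="cstarAlgType")]
HB.structure Definition CstarAlgebra (R : realType) :=
  {A of StarRing_isCstarAlgebra R A & CompleteNormedModule R[i] A & StarRing A}.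

Section StarRingTheory.
Variable A : starRingType.

Lemma smul0l (x : A) : smul 0 x = 0.
Proof. by apply: (addrI (smul 0 x)); rewrite -smulDl !addr0. Qed.

Lemma smul0r (x : A) : smul x 0 = 0.
Proof. by apply: (addrI (smul x 0)); rewrite -smulDr !addr0. Qed.

Lemma star0 : star 0 = 0 :> A.
Proof. by apply: (addrI (star 0)); rewrite -starD !addr0. Qed.

Lemma smul_suml (I : Type) (r : seq I) (F : I -> A) (x : A) :
  smul (\sum_(i <- r) F i) x = \sum_(i <- r) smul (F i) x.
Proof. exact: (big_morph (smul^~ x) (fun a b => smulDl a b x) (smul0l x)). Qed.

Lemma smul_sumr (I : Type) (r : seq I) (F : I -> A) (x : A) :
  smul x (\sum_(i <- r) F i) = \sum_(i <- r) smul x (F i).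
Proof. exact: (big_morph (smul x) (smulDr x) (smul0r x)). Qed.

Lemma star_sum (I : Type) (r : seq I) (F : I -> A) :
  star (\sum_(i <- r) F i) = \sum_(i <- r) star (F i).
Proof. exact: (big_morph star starD star0). Qed.

End StarRingTheory.

Section MatrixStarRing.
Variables (A : starRingType) (n : nat).

Definition mx_smul (X Y : 'M[A]_n) : 'M[A]_n :=
  \matrix_(i, j) \sum_k smul (X i k) (Y k j).

Definition mx_star (X : 'M[A]_n) : 'M[A]_n := \matrix_(i, j) star (X j i).

Lemma mx_smulA : associative mx_smul.
Proof.
move=> X Y Z; apply/matrixP => i j; rewrite !mxE.
under eq_bigr => k _ do rewrite mxE smul_sumr.
rewrite exchange_big /=; apply: eq_bigr => l _; rewrite mxE smul_suml.
by apply: eq_bigr => k _; rewrite smulA.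
Qed.

Lemma mx_smulDl : left_distributive mx_smul +%R.
Proof.
move=> X Y Z; apply/matrixP => i j; rewrite !mxE -big_split /=.
by apply: eq_bigr => k _; rewrite mxE smulDl.
Qed.

Lemma mx_smulDr : right_distributive mx_smul +%R.
Proof.
move=> X Y Z; apply/matrixP => i j; rewrite !mxE -big_split /=.
by apply: eq_bigr => k _; rewrite mxE smulDr.
Qed.

Lemma mx_starK : involutive mx_star.
Proof. by move=> X; apply/matrixP => i j; rewrite !mxE starK. Qed.

Lemma mx_starD : {morph mx_star : X Y / X + Y}.
Proof. by move=> X Y; apply/matrixP => i j; rewrite !mxE starD. Qed.

Lemma mx_starM X Y : mx_star (mx_smul X Y) = mx_smul (mx_star Y) (mx_star X).
Proof.
apply/matrixP => i j; rewrite !mxE star_sum.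
by apply: eq_bigr => k _; rewrite !mxE starM.
Qed.

HB.instance Definition _ := Zmodule_isStarRing.Build 'M[A]_n
  mx_smulA mx_smulDl mx_smulDr mx_starK mx_starD mx_starM.

End MatrixStarRing.

Definition selfadjoint (A : starRingType) (a : A) : Prop := star a = a.

(* Positivity and the order depend only on the *-ring structure, so they apply
   to M_n(A) without constructing its C*-norm. *)
Definition positive (A : starRingType) (a : A) : Prop :=
  exists b : A, a = smul (star b) b.

Definition sale (A : starRingType) (a b : A) : Prop :=
  [/\ selfadjoint a, selfadjoint b & positive (b - a)].

Definition positive_map (A B : starRingType) (Phi : A -> B) : Prop :=
  forall a : A, positive a -> positive (Phi a).

Definition Smonp (A B : starRingType) (n : nat) (Phi : A -> B) : Prop :=
  positive_map Phi /\
  forall X Y : 'M[A]_n,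
    sale 0 Y -> sale Y X -> sale (map_mx Phi Y) (map_mx Phi X).

(* Main.v *)
Require Import Defs.
From mathcomp Require Import all_boot all_order all_algebra.
From mathcomp Require Import complex.
From mathcomp Require Import all_classical all_reals all_analysis.
From mathcomp Require Import ring lra.
Import Order.TTheory GRing.Theory Num.Theory.
Import numFieldNormedType.Exports.
Local Open Scope ring_scope.
Local Open Scope complex_scope.

(** Fix a positive [a] and write [g s = Phi (s a)] for real [s >= 0].  For
    [0 <= h <= x] the matrix [Y] with all entries [x a] is positive, and adding
    the positive matrix [D] with entries [h a] on the diagonal and [- h a] off
    it gives [X >= Y >= 0].  By monotonicity the matrix with diagonal entries
    [g (x + h) - g x] and off-diagonal entries [g (x - h) - g x] is positive;
    pairing it with the vector [(1, 1)] yields [g (x + h) + g (x - h) >= 2 g x]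
    ([midpoint_convex]).  Midpoint convexity and [g 0 = 0] give
    [g c <= c g 1] for [c] in a dense subset of the unit interval
    ([midpoint_closed_dense]), and then for every [c] in it because [Phi] is
    continuous and the positive cone is closed ([subhomogeneous]).  So
    [Phi 0 = 0] gives [Phi (c a) <= c Phi a] for [c <= 1].  Replacing [a] by
    [c a] and [c] by its inverse gives the reverse inequality for [c >= 1].
    That one, at [c = 2] and [a = 0], makes both [Phi 0] and [- Phi 0]
    positive, so [Phi 0 = 0].

    What remains is the theory of the cone of elements [b^* b] in a C*-algebra
    that may have no unit: it is stable under sums, closed, and contains no
    nonzero [x] together with [- x].  The unit is replaced by the operators
    [umul k a], left multiplication by [k + a], and the spectrum by the
    condition [nonneg x]: [x] is selfadjoint and [t - x] acts with norm at most
    [t] for some [t > 0].  With this definition stability under sums is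
    immediate.  The two conditions are equivalent:
    - [nonneg x] gives a square root of [x], from the iteration
      [w := (z + w^2) / 2] for a contraction [z], whose limit is
      [1 - sqrt (1 - z)] ([umul_sqrt_exists], [nonneg_sqrt]);
    - a selfadjoint square [h^2] of norm at most one satisfies
      [|1 - h^2| <= 1], since [sqrt (1 - h^2)] is the mean of the unitaries
      [sqrt (1 - h^2) + i h] and [sqrt (1 - h^2) - i h] ([sqr_mul_bound]);
    - every [b^* b] is such a square ([positive_nonneg], a form of the theorem
      of Fukamiya and Kaplansky).
    The bound in the second item depends on the norm of the element only, which
    makes the cone closed ([positive_closed]). *)

Set Implicit Arguments.
Unset Strict Implicit.

(** * Linear identities in a module *)

(** In a module over a noncommutative algebra, identities between linear
    combinations of products are decided by comparing the coefficients of each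
    product.  The syntax below reflects such combinations, so that [module_eq]
    leaves only equalities between scalars. *)
Section LinearCombination.
Variables (K : pzRingType) (V : lmodType K).

Inductive lincomb :=
  | LCatom of nat
  | LCzero
  | LCadd of lincomb & lincomb
  | LCopp of lincomb
  | LCscale of K & lincomb.

Fixpoint lincomb_eval (env : seq V) (e : lincomb) : V :=
  match e with
  | LCatom n => nth 0 env n
  | LCzero => 0
  | LCadd e1 e2 => lincomb_eval env e1 + lincomb_eval env e2
  | LCopp e1 => - lincomb_eval env e1
  | LCscale k e1 => k *: lincomb_eval env e1
  end.

Fixpoint lincomb_coef (e : lincomb) (i : nat) : K :=
  match e with
  | LCatom n => if Nat.eqb n i then 1 else 0
  | LCzero => 0
  | LCadd e1 e2 => lincomb_coef e1 i + lincomb_coef e2 i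
  | LCopp e1 => - lincomb_coef e1 i
  | LCscale k e1 => k * lincomb_coef e1 i
  end.

Fixpoint same_coefs (e1 e2 : lincomb) (n : nat) : Prop :=
  match n with
  | 0%N => True
  | n'.+1 => lincomb_coef e1 n' = lincomb_coef e2 n' /\ same_coefs e1 e2 n'
  end.

Lemma lincomb_evalE (env : seq V) (e : lincomb) :
  lincomb_eval env e = \sum_(i < size env) lincomb_coef e i *: env`_i.
Proof.
elim: e => [n||e1 IH1 e2 IH2|e1 IH1|k e1 IH1] /=.
- have [ltn|gen] := ltnP n (size env).
    rewrite (bigD1 (Ordinal ltn)) //= PeanoNat.Nat.eqb_refl scale1r.
    rewrite big1 ?addr0 // => i; rewrite -val_eqE /= => /eqP ne_in.
    case: (PeanoNat.Nat.eqb_spec n i) => [e|_]; first by case: ne_in.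
    by rewrite scale0r.
  rewrite nth_default // big1 // => i _.
  case: (PeanoNat.Nat.eqb_spec n i) => [e|_]; last by rewrite scale0r.
  by move: (ltn_ord i); rewrite -e ltnNge gen.
- by rewrite big1 // => i _; rewrite scale0r.
- by rewrite IH1 IH2 -big_split; apply: eq_bigr => i _; rewrite scalerDl.
- by rewrite IH1 -sumrN; apply: eq_bigr => i _; rewrite scaleNr.
- by rewrite IH1 scaler_sumr; apply: eq_bigr => i _; rewrite scalerA.
Qed.

Lemma lincomb_eq (env : seq V) (e1 e2 : lincomb) :
  same_coefs e1 e2 (size env) -> lincomb_eval env e1 = lincomb_eval env e2.
Proof.
move=> eq12; rewrite !lincomb_evalE; apply: eq_bigr => i _; congr (_ *: _).
elim: (size env) i eq12 => [[]//|n IH] i /= [eqn eq12].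
have [ltin|] := ltnP i n; first exact: (IH (Ordinal ltin)).
move=> leni; suff -> : i = n :> nat by [].
by apply/eqP; rewrite eqn_leq leni -ltnS ltn_ord.
Qed.

End LinearCombination.

(* Atoms are compared up to conversion: one product of the algebra may be
   displayed through several canonical instances. *)
Ltac lc_index x env :=
  match env with
  | cons ?y _ => let _ := match goal with _ => unify x y end in constr:(0%N)
  | cons _ ?env' => let n := lc_index x env' in constr:(S n)
  end.

Ltac lc_insert x env :=
  match env with
  | _ => let _ := lc_index x env in env
  | _ => constr:(cons x env)
  end.

Ltac lc_atoms t env :=
  lazymatch t with
  | (?a + ?b)%R => let env' := lc_atoms a env in lc_atoms b env'
  | (- ?a)%R => lc_atoms a env
  | (_ *: ?a)%R => lc_atoms a env
  | 0%R => env
  | _ => lc_insert t env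
  end.

Ltac lc_reify K t env :=
  lazymatch t with
  | (?a + ?b)%R =>
      let ea := lc_reify K a env in
      let eb := lc_reify K b env in constr:(@LCadd K ea eb)
  | (- ?a)%R => let ea := lc_reify K a env in constr:(@LCopp K ea)
  | (?k *: ?a)%R => let ea := lc_reify K a env in constr:(@LCscale K k ea)
  | 0%R => constr:(@LCzero K)
  | _ => let n := lc_index t env in constr:(@LCatom K n)
  end.

Ltac module_eq K V :=
  lazymatch goal with
  | |- ?l = ?r =>
      let env := lc_atoms l (@nil V) in
      let env := lc_atoms r env in
      let el := lc_reify K l env in
      let er := lc_reify K r env in
      change (@lincomb_eval K V env el = @lincomb_eval K V env er);
      apply: lincomb_eq;
      cbv [same_coefs size lincomb_coef Nat.eqb];
      repeat (split; [|]); try exact I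
  end.

(** * Real norms *)

Section CstarNorm.
Variables (R : realType) (A : cstarAlgType R).
Implicit Types (x y a b : A) (c t : R).

Lemma smulZl (k : R[i]) x y : smul (k *: x) y = k *: smul x y.
Proof. exact: scale_smull. Qed.

Lemma smulZr (k : R[i]) x y : smul x (k *: y) = k *: smul x y.
Proof. exact: scale_smulr. Qed.

Lemma smulNl x y : smul (- x) y = - smul x y.
Proof. by apply/eqP; rewrite -addr_eq0 -smulDl addNr smul0l. Qed.

Lemma smulNr x y : smul x (- y) = - smul x y.
Proof. by apply/eqP; rewrite -addr_eq0 -smulDr addNr smul0r. Qed.

Lemma starN x : star (- x) = - star x.
Proof. by apply/eqP; rewrite -addr_eq0 -starD addNr star0. Qed.

Lemma starZr c x : star (c%:C *: x) = c%:C *: star x.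
Proof. by rewrite starZ; congr (_ *: _); exact: conjc_real. Qed.

(** The norm of a complex normed module is valued in [R[i]]; its real part
    carries all the information and lives in an ordered field. *)
Definition nrm x : R := complex.Re `|x|.

Lemma nrmE x : `|x| = (nrm x)%:C.
Proof. by rewrite /nrm RRe_real //; exact: (ger0_real (normr_ge0 x)). Qed.

Lemma nrm_ge0 x : 0 <= nrm x.
Proof. by rewrite -lecR -nrmE; exact: (normr_ge0 x). Qed.

Lemma nrm_le0 x : nrm x <= 0 -> x = 0.
Proof. by move=> x0; apply/eqP; rewrite -normr_le0 nrmE lecR. Qed.

Lemma nrm0 : nrm 0 = 0.
Proof. by rewrite /nrm normr0. Qed.

Lemma nrmN x : nrm (- x) = nrm x.
Proof. by rewrite /nrm normrN. Qed.

Lemma nrm_distC x y : nrm (x - y) = nrm (y - x).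
Proof. by rewrite -nrmN opprB. Qed.

Lemma nrmD x y : nrm (x + y) <= nrm x + nrm y.
Proof. by rewrite -lecR rmorphD /= -!nrmE ler_normD. Qed.

Lemma nrmB x y : nrm (x - y) <= nrm x + nrm y.
Proof. by rewrite -(nrmN y) nrmD. Qed.

Lemma nrm_dist_trans y x z : nrm (x - z) <= nrm (x - y) + nrm (y - z).
Proof. by have -> : x - z = (x - y) + (y - z); [rewrite subrKA|rewrite nrmD]. Qed.

Lemma nrmZ c x : nrm (c%:C *: x) = `|c| * nrm x.
Proof.
apply: complexI; rewrite rmorphM /= -!nrmE normrZ; congr (_ * _).
by rewrite normc_def /= expr0n /= addr0 sqrtr_sqr.
Qed.

Lemma nrmZ_ge0 c x : 0 <= c -> nrm (c%:C *: x) = c * nrm x.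
Proof. by move=> c0; rewrite nrmZ ger0_norm. Qed.

Lemma nrm_smul x y : nrm (smul x y) <= nrm x * nrm y.
Proof. by rewrite -lecR rmorphM /= -!nrmE normr_smul_le. Qed.

Lemma nrm_cstar x : nrm (smul (star x) x) = nrm x ^+ 2.
Proof. by apply: complexI; rewrite rmorphXn /= -!nrmE cstar_identity. Qed.

Lemma nrm_star x : nrm (star x) = nrm x.
Proof.
have le_star z : nrm z <= nrm (star z).
  have [z0|z_gt0] := leP (nrm z) 0; first exact: le_trans z0 (nrm_ge0 _).
  by rewrite -(ler_pM2r z_gt0) -expr2 -nrm_cstar nrm_smul.
by apply/eqP; rewrite eq_le le_star -{2}(starK x) le_star.
Qed.

Lemma cstar_eq0 x : smul (star x) x = 0 -> x = 0.
Proof.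
move=> x0; apply: nrm_le0; rewrite leNgt; apply/negP => x_gt0.
by have := exprn_gt0 2 x_gt0; rewrite -nrm_cstar x0 nrm0 ltxx.
Qed.

(** Taking [y = a^*] shows that left multiplication by [a] has operator norm
    [nrm a]: bounds on operators are bounds on elements. *)
Lemma left_mul_bound a c : 0 <= c ->
  (forall y, nrm (smul a y) <= c * nrm y) -> nrm a <= c.
Proof.
move=> c0 ac; have [a0|a_gt0] := leP (nrm a) 0; first exact: le_trans a0 c0.
rewrite -(ler_pM2r a_gt0) -expr2 -nrm_star -nrm_cstar starK.
exact: ac.
Qed.

Lemma left_mul_inj a b : (forall y, smul a y = smul b y) -> a = b.
Proof.
move=> ab; apply/eqP; rewrite -subr_eq0; apply/eqP/nrm_le0.
by apply: left_mul_bound => // y; rewrite smulDl smulNl ab subrr nrm0 mul0r.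
Qed.

(** Completeness with the rate of convergence, so that limits can be used
    through estimates alone. *)
Lemma nrm_complete (u : nat -> A) (e : nat -> R) :
  (forall n m, (n <= m)%N -> nrm (u m - u n) <= e n) ->
  (forall eps, 0 < eps -> exists n, e n <= eps) ->
  exists l, forall n, nrm (l - u n) <= e n.
Proof.
move=> ue e0.
have u_cvg : cvgn u.
  apply/cauchy_cvgP/cauchy_exP => eps eps0.
  have eps_real : (complex.Re eps)%:C = eps by rewrite RRe_real ?gtr0_real.
  have re_gt0 : 0 < complex.Re eps by rewrite -ltcR eps_real.
  have [n en] := e0 _ (divr_gt0 re_gt0 (ltr0Sn R 1)).
  exists (u n); exists n => // m /= nm; rewrite -ball_normE /=.
  rewrite -eps_real nrmE ltcR nrm_distC.
  apply: le_lt_trans (ue _ _ nm) _; apply: le_lt_trans en _; lra.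
exists (limn u) => n; apply/ler_addgt0Pr => eps eps0.
have /cvgrPdist_lt /(_ eps%:C) := u_cvg; rewrite ltcR => /(_ eps0) [N _ uN].
have := uN (maxn n N) (leq_maxr _ _); rewrite nrmE ltcR => /ltW lim_near.
apply: le_trans (nrm_dist_trans (u (maxn n N)) _ _) _.
by rewrite addrC lerD ?ue ?leq_maxl.
Qed.

End CstarNorm.

(** * Square roots in the unitization *)

(** The scalar iteration for [1 - sqrt (1 - z)] at [z = 1].  It increases to
    [1] and dominates, step by step, the same iteration for any contraction
    [z]. *)
Section SqrtIteration.
Variable R : realType.

Fixpoint sqrt_iter (n : nat) : R :=
  if n is n'.+1 then (1 + sqrt_iter n' ^+ 2) / 2 else 0.

Lemma sqrt_iter_bounds n : 0 <= sqrt_iter n <= 1.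
Proof. by elim: n => [|n /= /andP[w0 w1]]; rewrite ?lexx ?ler01 //; nra. Qed.

Lemma sqrt_iter_le n m : (n <= m)%N -> sqrt_iter n <= sqrt_iter m.
Proof.
elim: m => [|m IH]; first by rewrite leqn0 => /eqP ->.
rewrite leq_eqVlt => /orP[/eqP -> //|]; rewrite ltnS => /IH nm.
by apply: le_trans nm _ => /=; have := sqr_ge0 (sqrt_iter m - 1); nra.
Qed.

(** With [d = 1 - w] the step reads [d := d (1 - d / 2)], so [1 / d] grows by
    at least [1 / 2] each time. *)
Lemma sqrt_iter_rate n : (1 - sqrt_iter n) * (n%:R + 2) <= 2.
Proof.
elim: n => [|n IH]; first by rewrite /=; lra.
have /andP[w0 w1] := sqrt_iter_bounds n.
have n0 : 0 <= n%:R :> R by exact: ler0n.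
rewrite -natr1 /=; set w := sqrt_iter n in w0 w1 IH *; set x := n%:R in n0 IH *.
have h0 : 0 <= (1 - w) * (2 - (1 - w) * (x + 2)) by apply: mulr_ge0; lra.
have h1 : 0 <= w * (2 - (1 - w) * (x + 2)) by apply: mulr_ge0; lra.
nra.
Qed.

Lemma sqrt_iter_near1 (eps : R) : 0 < eps -> exists n, 1 - sqrt_iter n <= eps.
Proof.
move=> eps0; set n := Num.bound (2 / eps); exists n.
have := archi_boundP (ltW (divr_gt0 (ltr0Sn R 1) eps0)); rewrite -/n.
rewrite ltr_pdivrMr // => ltn.
have /andP[w0 w1] := sqrt_iter_bounds n; have rate := sqrt_iter_rate n.
rewrite leNgt; apply/negP => lt_eps.
have : n%:R * eps <= n%:R * (1 - sqrt_iter n) by rewrite ler_wpM2l ?ler0n ?ltW.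
lra.
Qed.

Lemma sqrt_iter_limit (x C : R) :
  0 <= C -> (forall n, x <= C * (1 - sqrt_iter n)) -> x <= 0.
Proof.
move=> C0 xC; apply/ler_addgt0Pr => eps eps0; rewrite add0r.
have C1 : 0 < C + 1 by lra.
have [n wn] := sqrt_iter_near1 (divr_gt0 eps0 C1).
rewrite ler_pdivlMr // in wn.
have /andP[_ w1] := sqrt_iter_bounds n; have := xC n; nra.
Qed.

End SqrtIteration.

Section Unitization.
Variables (R : realType) (A : cstarAlgType R).
Implicit Types (x y z a b d : A) (k l : R[i]) (c t : R).

(** Left multiplication by [k + a] in the unitization of [A]. *)
Definition umul k a y : A := k *: y + smul a y.

Lemma smul_assoc x y z : smul x (smul y z) = smul (smul x y) z.
Proof. exact: smulA. Qed.

Definition smulE := (@smulDl A, @smulDr A, @smulNl R A, @smulNr R A,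
  @smulZl R A, @smulZr R A, smul_assoc, @smul0l A, @smul0r A).

Lemma umulB k a y z : umul k a (y - z) = umul k a y - umul k a z.
Proof. rewrite /umul !smulE; module_eq R[i] A; ring. Qed.

Lemma umul_le c a t y : nrm (umul c%:C a y) <= t * nrm y ->
  nrm (smul a y) <= (t + `|c|) * nrm y.
Proof.
have -> : smul a y = umul c%:C a y - c%:C *: y.
  by rewrite /umul; module_eq R[i] A; ring.
by move=> ay; apply: le_trans (nrmB _ _) _; rewrite nrmZ mulrDl lerD2r.
Qed.

(** For [z = e + a0] the sequence [w := (z + w^2) / 2], started at [0], stays
    within the algebra generated by [z], and the difference of two consecutive
    terms is bounded by that of the scalar sequence [sqrt_iter], because
    [u^2 - v^2 = u (u - v) + (u - v) v].  Since that scalar sequence converges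
    even when [z] has norm one, so does [w]; its limit solves
    [2 w = z + w^2].  The unit coefficient [e] is [0] or [1] so that the scalar
    part of the iterates is [e * sqrt_iter n]: [e = 0] gives roots of
    [1 - a0], [e = 1] gives roots of elements of [A]. *)
Lemma umul_sqrt_exists (e : R) a0 : e = 0 \/ e = 1 -> selfadjoint a0 ->
  (forall y, nrm (umul e%:C a0 y) <= nrm y) ->
  exists a, [/\ selfadjoint a,
    forall d, smul d a0 = smul a0 d -> smul d a = smul a d,
    2%:C *: a = a0 + (2 * e)%:C *: a + smul a a &
    forall y, nrm (umul e%:C a y) <= nrm y].
Proof.
move=> e01 a0_sa a0_le.
have [e0 e1] : 0 <= e /\ e <= 1 by case: e01 => ->.
pose w := sqrt_iter R.
have w0 n : 0 <= w n by have /andP[] := sqrt_iter_bounds R n.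
have w1 n : w n <= 1 by have /andP[] := sqrt_iter_bounds R n.
have wS n : w n.+1 = (1 + w n ^+ 2) / 2 by [].
have w_le n m : (n <= m)%N -> w n <= w m := @sqrt_iter_le R n m.
pose a := fix a n := if n is n'.+1 then
  2^-1%:C *: (a0 + (2 * e * w n')%:C *: a n' + smul (a n') (a n')) else 0.
have w_near := @sqrt_iter_near1 R.
have w_limit := @sqrt_iter_limit R.
rewrite -/w in w_near w_limit.
have aS n : a n.+1 =
  2^-1%:C *: (a0 + (2 * e * w n)%:C *: a n + smul (a n) (a n)) by [].
have [w00 a00] : w 0%N = 0 /\ a 0%N = 0 by [].
clearbody w a.
pose W n y := umul (e * w n)%:C (a n) y.
have WS n y : W n.+1 y = 2^-1%:C *: (umul e%:C a0 y + W n (W n y)).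
  rewrite /W aS wS /umul !smulE.
  by case: e01 => ->; module_eq R[i] A; field.
have W_le n y : nrm (W n y) <= w n * nrm y.
  elim: n y => [|n IH] y.
    by rewrite /W /umul w00 a00 mulr0 smul0l scale0r addr0 nrm0 mul0r.
  rewrite WS nrmZ_ge0 ?invr_ge0 // wS mulrAC mulrC ler_pM2r ?invr_gt0 //.
  apply: le_trans (nrmD _ _) _; rewrite mulrDl mul1r lerD ?a0_le // expr2 -mulrA.
  by apply: le_trans (IH _) _; rewrite ler_wpM2l.
have WB n y z : W n (y - z) = W n y - W n z by apply: umulB.
have W_step n y : nrm (W n.+1 y - W n y) <= (w n.+1 - w n) * nrm y.
  elim: n y => [|n IH] y.
    rewrite {2}/W /umul w00 a00 mulr0 smul0l scale0r addr0 !subr0.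
    exact: W_le.
  have -> : W n.+2 y - W n.+1 y = 2^-1%:C *:
      (W n.+1 (W n.+1 y - W n y) + (W n.+1 (W n y) - W n (W n y))).
    rewrite (WS n.+1 y) [X in _ - X = _]WS WB; module_eq R[i] A; ring.
  rewrite nrmZ_ge0 ?invr_ge0 // ler_pdivrMl //; apply: le_trans (nrmD _ _) _.
  have wn : w n <= w n.+1 by apply: w_le.
  have h1 : nrm (W n.+1 (W n.+1 y - W n y)) <=
      w n.+1 * ((w n.+1 - w n) * nrm y).
    by apply: le_trans (W_le _ _) _; rewrite ler_wpM2l.
  have h2 : nrm (W n.+1 (W n y) - W n (W n y)) <=
      (w n.+1 - w n) * (w n * nrm y).
    by apply: le_trans (IH _) _; rewrite ler_wpM2l ?subr_ge0.
  apply: le_trans (lerD h1 h2) _; rewrite (wS n.+1) (wS n) le_eqVlt; apply/orP.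
  by left; apply/eqP; field.
have W_dist n m y : (n <= m)%N -> nrm (W m y - W n y) <= (w m - w n) * nrm y.
  elim: m => [|m IH]; first by rewrite leqn0 => /eqP ->; rewrite !subrr nrm0 mul0r.
  rewrite leq_eqVlt => /orP[/eqP ->|]; first by rewrite !subrr nrm0 mul0r.
  rewrite ltnS => /IH nm; apply: le_trans (nrm_dist_trans (W m y) _ _) _.
  apply: le_trans (lerD (W_step m y) nm) _; rewrite -mulrDl.
  by rewrite ler_wpM2r ?nrm_ge0 //; lra.
have a_dist n m : (n <= m)%N -> nrm (a m - a n) <= 2 * (1 - w n).
  move=> nm; have wnm := w_le _ _ nm; have wm1 := w1 m.
  apply: le_trans (_ : (w m - w n) + `|e * (w m - w n)| <= _); last first.
    rewrite ger0_norm; last by rewrite mulr_ge0 ?subr_ge0.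
    have : e * (w m - w n) <= 1 * (w m - w n) by rewrite ler_wpM2r ?subr_ge0.
    lra.
  apply: left_mul_bound => [|y]; first by rewrite addr_ge0 ?subr_ge0.
  apply: umul_le; apply: le_trans (W_dist n m y nm).
  rewrite le_eqVlt; apply/orP; left; apply/eqP; congr nrm.
  by rewrite /W /umul !smulE; module_eq R[i] A; ring.
have rate0 eps : 0 < eps -> exists n, 2 * (1 - w n) <= eps.
  move=> eps0; have [n] := w_near _ (divr_gt0 eps0 (ltr0Sn R 1)).
  by exists n; lra.
have [l al] := nrm_complete a_dist rate0.
have small x C : 0 <= C -> (forall n, nrm x <= C * (1 - w n)) -> x = 0.
  by move=> C0 xC; apply: nrm_le0; apply: w_limit C0 xC.
have a_sa n : selfadjoint (a n).
  rewrite /selfadjoint; elim: n => [|n IH]; first by rewrite a00 star0.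
  by rewrite aS starZr !starD starZr starM IH a0_sa.
have a_comm d n : smul d a0 = smul a0 d -> smul d (a n) = smul (a n) d.
  move=> da0; elim: n => [|n IH]; first by rewrite a00 smul0l smul0r.
  by rewrite aS !smulE da0 IH -!smul_assoc IH.
pose L y := umul e%:C l y.
have LW n y : nrm (L y - W n y) <= 3 * (1 - w n) * nrm y.
  have -> : L y - W n y = (e * (1 - w n))%:C *: y + smul (l - a n) y.
    by rewrite /L /W /umul !smulE; module_eq R[i] A; ring.
  have wn0 : 0 <= 1 - w n by rewrite subr_ge0.
  apply: le_trans (nrmD _ _) _; rewrite nrmZ_ge0 ?mulr_ge0 //.
  have h1 : e * (1 - w n) * nrm y <= 1 * (1 - w n) * nrm y.
    by rewrite ler_wpM2r ?nrm_ge0 // ler_wpM2r.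
  have h2 : nrm (smul (l - a n) y) <= 2 * (1 - w n) * nrm y.
    by apply: le_trans (nrm_smul _ _) _; rewrite ler_wpM2r ?nrm_ge0.
  lra.
have L_le y : nrm (L y) <= nrm y.
  rewrite -subr_le0; apply: (w_limit _ (3 * nrm y)) => [|n].
    by rewrite mulr_ge0 ?nrm_ge0.
  have := nrmD (L y - W n y) (W n y); rewrite subrK => h.
  have h1 : w n * nrm y <= 1 * nrm y by rewrite ler_wpM2r ?nrm_ge0.
  have := LW n y; have := W_le n y; lra.
have L_fix y : L y = 2^-1%:C *: (umul e%:C a0 y + L (L y)).
  apply/eqP; rewrite -subr_eq0; apply/eqP.
  apply: (small _ (6 * nrm y)) => [|n]; first by rewrite mulr_ge0 ?nrm_ge0.
  have -> : L y - 2^-1%:C *: (umul e%:C a0 y + L (L y)) = (L y - W n.+1 y) -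
      2^-1%:C *: ((L (L y) - W n (L y)) + W n (L y - W n y)).
    by rewrite (WS n y) WB; module_eq R[i] A; field.
  apply: le_trans (nrmB _ _) _; rewrite nrmZ_ge0 ?invr_ge0 //.
  have h1 : nrm (L y - W n.+1 y) <= 3 * (1 - w n) * nrm y.
    apply: le_trans (LW _ _) _; rewrite ler_wpM2r ?nrm_ge0 // ler_wpM2l //.
    by rewrite lerD2l lerN2 w_le.
  have h2 : nrm (L (L y) - W n (L y)) <= 3 * (1 - w n) * nrm y.
    by apply: le_trans (LW _ _) _; rewrite ler_wpM2l ?mulr_ge0 ?subr_ge0.
  have h3 : nrm (W n (L y - W n y)) <= 3 * (1 - w n) * nrm y.
    apply: le_trans (W_le _ _) _; apply: le_trans (LW n y).
    by rewrite -[leRHS]mul1r ler_wpM2r ?nrm_ge0.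
  have := nrmD (L (L y) - W n (L y)) (W n (L y - W n y)); lra.
exists l; split=> //.
- apply/eqP; rewrite -subr_eq0; apply/eqP; apply: (small _ 4) => // n.
  apply: le_trans (nrm_dist_trans (a n) _ _) _.
  by rewrite -{1}(a_sa n) -starN -starD nrm_star nrm_distC; have := al n; lra.
- move=> d da0; apply/eqP; rewrite -subr_eq0; apply/eqP.
  apply: (small _ (4 * nrm d)) => [|n]; first by rewrite mulr_ge0 ?nrm_ge0.
  have -> : smul d l - smul l d = smul d (l - a n) - smul (l - a n) d.
    by rewrite !smulE (a_comm d n da0); module_eq R[i] A; ring.
  apply: le_trans (nrmB _ _) _.
  apply: le_trans (lerD (nrm_smul _ _) (nrm_smul _ _)) _.
  have : nrm d * nrm (l - a n) <= nrm d * (2 * (1 - w n)).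
    by rewrite ler_wpM2l ?nrm_ge0.
  by rewrite [nrm (l - a n) * _]mulrC; lra.
- apply: left_mul_inj => y; have := L_fix y.
  rewrite /L /umul !smulE => fix_y.
  apply/eqP; rewrite -subr_eq0; apply/eqP.
  have := congr1 (fun z => z - (e%:C *: y + smul l y)) fix_y.
  rewrite subrr => zero.
  have -> : (0 : A) = (- 2)%:C *: 0 by rewrite scaler0.
  by rewrite zero; case: e01 => ->; module_eq R[i] A; field.
Qed.

End Unitization.

(** * Positivity through left multiplication *)

Section PowerGrowth.
Variable R : realType.

(** The part of the spectral radius formula that is needed: powers growing at
    most linearly force [r <= 1]. *)
Lemma pow2_linear_growth (r C : R) : 0 <= C ->
  (forall k, r ^+ (2 ^ k) <= 1 + (2 ^ k)%:R * C) -> r <= 1.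
Proof.
move=> C0 rC; rewrite leNgt; apply/negP => r1; set d := r - 1.
have d0 : 0 < d by rewrite subr_gt0.
have bernoulli k : 1 + (2 ^ k)%:R * d <= r ^+ (2 ^ k).
  elim: k => [|k IH]; first by rewrite expr1 mul1r /d; lra.
  rewrite expnS natrM mulnC exprM; set X := (2 ^ k)%:R in IH *.
  have X0 : 0 <= X * d by rewrite mulr_ge0 ?ler0n ?ltW.
  have : (1 + X * d) ^+ 2 <= (r ^+ (2 ^ k)) ^+ 2 by rewrite ler_sqr ?nnegrE; lra.
  have := sqr_ge0 (X * d); lra.
have bound k : (2 ^ k)%:R * d ^+ 2 <= 2 * C.
  have X0 : 0 < (2 ^ k)%:R :> R by rewrite ltr0n expn_gt0.
  have := rC k.+1; rewrite expnS natrM mulnC exprM; move: (bernoulli k).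
  set X := (2 ^ k)%:R in X0 * => h1 h2.
  have X1 : 0 <= X * d by rewrite mulr_ge0 ?ltW.
  have h3 : (1 + X * d) ^+ 2 <= (r ^+ (2 ^ k)) ^+ 2 by rewrite ler_sqr ?nnegrE; lra.
  rewrite -(ler_pM2l X0); lra.
have d2 : 0 < d ^+ 2 by rewrite exprn_gt0.
set n := Num.bound (2 * C / d ^+ 2).
have /archi_boundP : 0 <= 2 * C / d ^+ 2 by rewrite divr_ge0 ?mulr_ge0 // ltW.
rewrite -/n ltr_pdivrMr // => ltn.
have : n%:R * d ^+ 2 <= (2 ^ n)%:R * d ^+ 2.
  by rewrite ler_pM2r // ler_nat ltnW // ltn_expl.
by have := bound n; lra.
Qed.

End PowerGrowth.

Section Positivity.
Variables (R : realType) (A : cstarAlgType R).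
Implicit Types (x y z a b c d h p q r : A) (t : R).

Local Notation smulE := (smulE A).

Definition mul_bound t x := forall y, nrm (umul t%:C (- x) y) <= t * nrm y.

(** The analogue, without spectrum, of having a spectrum in the nonnegative
    reals: in the unitization, [t - x] has norm at most [t]. *)
Definition nonneg x := selfadjoint x /\ exists2 t, 0 < t & mul_bound t x.

Lemma selfadjointB x y : selfadjoint x -> selfadjoint y -> selfadjoint (x - y).
Proof. by rewrite /selfadjoint starD starN => -> ->. Qed.

Lemma selfadjointD x y : selfadjoint x -> selfadjoint y -> selfadjoint (x + y).
Proof. by rewrite /selfadjoint starD => -> ->. Qed.

Lemma selfadjointZ t x : selfadjoint x -> selfadjoint (t%:C *: x).
Proof. by rewrite /selfadjoint starZr => ->. Qed.

Lemma selfadjoint_sqr x : selfadjoint x -> selfadjoint (smul x x).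
Proof. by rewrite /selfadjoint starM => ->. Qed.

Lemma nonnegD x y : nonneg x -> nonneg y -> nonneg (x + y).
Proof.
move=> [x_sa [s s0 xs]] [y_sa [t t0 yt]]; split; first exact: selfadjointD.
exists (s + t) => [|z]; first exact: addr_gt0.
have -> : umul (s + t)%:C (- (x + y)) z = umul s%:C (- x) z + umul t%:C (- y) z.
  by rewrite /umul !smulE; module_eq R[i] A; ring.
by rewrite mulrDl; apply: le_trans (nrmD _ _) _; rewrite lerD.
Qed.

Lemma nonnegZ s x : 0 < s -> nonneg x -> nonneg (s%:C *: x).
Proof.
move=> s0 [x_sa [t t0 xt]]; split; first exact: selfadjointZ.
exists (s * t) => [|z]; first exact: mulr_gt0.
have -> : umul (s * t)%:C (- (s%:C *: x)) z = s%:C *: umul t%:C (- x) z.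
  by rewrite /umul !smulE; module_eq R[i] A; ring.
by rewrite (nrmZ_ge0 _ (ltW s0)) -mulrA ler_pM2l.
Qed.

(** The solution of [2 w = 1 - x / t + w^2] from [umul_sqrt_exists] is
    [1 - r / sqrt t], where [r] is the root of [x].  That it is a contraction
    says that [r] is again [nonneg], so that [r] has a root in turn. *)
Lemma nonneg_sqrt x : nonneg x -> exists r, [/\ nonneg r, smul r r = x &
  forall d, smul d x = smul x d -> smul d r = smul r d].
Proof.
move=> [x_sa [t t0 xt]].
have [|y|a [a_sa a_comm a_fix a_le]] :=
    @umul_sqrt_exists R A 1 (- (t^-1%:C *: x)) (or_intror erefl).
- by rewrite /selfadjoint starN starZr x_sa.
- have ti0 : 0 < t^-1 by rewrite invr_gt0.
  have tt : t^-1%:C * t%:C = 1 by rewrite -rmorphM /= mulVf ?gt_eqF.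
  have -> : umul 1%:C (- (t^-1%:C *: x)) y = t^-1%:C *: umul t%:C (- x) y.
    by rewrite /umul !smulE; module_eq R[i] A; ring: tt.
  by rewrite (nrmZ_ge0 _ (ltW ti0)) ler_pdivrMl.
have aa : smul a a = t^-1%:C *: x.
  have -> : smul a a = 2%:C *: a + (t^-1%:C *: x - (2 * 1)%:C *: a).
    by rewrite {1}a_fix; module_eq R[i] A; ring.
  by module_eq R[i] A; ring.
exists (- ((Num.sqrt t)%:C *: a)).
have st0 : 0 < Num.sqrt t by rewrite sqrtr_gt0.
split.
- split; first by rewrite /selfadjoint starN starZr a_sa.
  exists (Num.sqrt t) => // y.
  have -> : umul (Num.sqrt t)%:C (- - ((Num.sqrt t)%:C *: a)) y =
      (Num.sqrt t)%:C *: umul 1%:C a y.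
    by rewrite opprK /umul !smulE; module_eq R[i] A; ring.
  by rewrite (nrmZ_ge0 _ (ltW st0)) ler_pM2l.
- rewrite !smulE aa opprK !scalerA -!rmorphM /= -expr2 sqr_sqrtr ?ltW //.
  by rewrite mulfV ?gt_eqF // scale1r.
- move=> d dx; rewrite !smulE a_comm // !smulE.
  by rewrite dx.
Qed.

Lemma umul_isometry a b : star a = b ->
  (forall y, umul 1 b (umul 1 a y) = y) -> forall y, nrm (umul 1 a y) = nrm y.
Proof.
move=> ab ba y; apply/eqP; rewrite -(eqrXn2 (n:=2)) ?nrm_ge0 // -!nrm_cstar.
rewrite -{4}(ba y) {1 3}/umul !scale1r starD starM ab !smulE.
by rewrite -!smul_assoc.
Qed.

End Positivity.

Section PositiveCone.
Variables (R : realType) (A : cstarAlgType R).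
Implicit Types (x y z a b c d h p q r : A) (t : R).

Local Notation smulE := (smulE A).
Local Notation i := ('i%C : R[i]).

Lemma mulii : i * i = -1.
Proof. by rewrite -expr2 sqr_i. Qed.

Lemma starZi x : star (i *: x) = - (i *: star x).
Proof. by rewrite starZ -scaleNr; congr (_ *: _); exact: conjCi. Qed.

(** With [g = h / sqrt t], a selfadjoint [1 - w] with square [1 - g^2] commutes
    with [g], so [1 - w + i g] and its adjoint are unitary.  Their mean [1 - w]
    is then a contraction, and so is its square [1 - h^2 / t]. *)
Lemma sqr_mul_bound t h : 0 < t -> selfadjoint h -> nrm (smul h h) <= t ->
  mul_bound t (smul h h).
Proof.
move=> t0 h_sa ht; have ti0 : 0 < t^-1 by rewrite invr_gt0.
pose g := t^-1%:C *: smul h h.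
have [||y|w [w_sa w_comm w_fix _]] := @umul_sqrt_exists R A 0 g.
- by left.
- exact/selfadjointZ/selfadjoint_sqr.
- rewrite /umul scale0r add0r; apply: le_trans (nrm_smul _ _) _.
  by rewrite ler_piMl ?nrm_ge0 // (nrmZ_ge0 _ (ltW ti0)) ler_pdivrMl // mulr1.
have wh : smul w h = smul h w.
  by rewrite -w_comm // /g !smulE.
have st0 : 0 < Num.sqrt t by rewrite sqrtr_gt0.
pose s := (Num.sqrt t)^-1; have ss : s%:C * s%:C = t^-1%:C.
  by rewrite -rmorphM /= /s -invfM -expr2 sqr_sqrtr ?ltW.
have w2 : smul w w = 2%:C *: w - t^-1%:C *: smul h h.
  by rewrite w_fix /g; module_eq R[i] A; ring.
pose u := i *: (s%:C *: h) - w; pose v := - (i *: (s%:C *: h)) - w.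
have uv : star u = v.
  by rewrite /u /v starD starN w_sa starZi starZr h_sa.
have vu : star v = u by rewrite -uv starK.
have uK y : umul 1 v (umul 1 u y) = y.
  by rewrite /umul !smulE wh w2 !smulE; module_eq R[i] A; ring: ss mulii.
have vK y : umul 1 u (umul 1 v y) = y.
  by rewrite /umul !smulE wh w2 !smulE; module_eq R[i] A; ring: ss mulii.
have S_le y : nrm (umul 1 (- w) y) <= nrm y.
  have -> : umul 1 (- w) y = 2^-1%:C *: (umul 1 u y + umul 1 v y).
    by rewrite /umul !smulE; module_eq R[i] A; field.
  rewrite nrmZ_ge0 ?invr_ge0 // ler_pdivrMl //; apply: le_trans (nrmD _ _) _.
  by rewrite (umul_isometry uv uK) (umul_isometry vu vK); lra.
have tt : t%:C * t^-1%:C = 1 by rewrite -rmorphM /= mulfV ?gt_eqF.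
move=> y.
have -> : umul t%:C (- smul h h) y = t%:C *: umul 1 (- w) (umul 1 (- w) y).
  by rewrite /umul !smulE w2 !smulE; module_eq R[i] A; ring: tt.
rewrite (nrmZ_ge0 _ (ltW t0)) ler_pM2l //.
exact: le_trans (S_le _) (S_le _).
Qed.

Lemma nonneg_sqr h : selfadjoint h -> nonneg (smul h h).
Proof.
move=> h_sa; split; first exact: selfadjoint_sqr.
exists (nrm (smul h h) + 1); first by have := nrm_ge0 (smul h h); lra.
by apply: sqr_mul_bound => //; have := nrm_ge0 (smul h h); lra.
Qed.

(** Let [b] and [c] be roots of [x] and [- x].  They commute, so [b - i c] has
    [(b - i c)^* (b - i c) = b^2 + c^2 = 0]; hence [b = i c] is both selfadjoint
    and skew-adjoint. *)
Lemma nonneg_antisym x : nonneg x -> nonneg (- x) -> x = 0.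
Proof.
move=> /nonneg_sqrt[b [[b_sa _] bx b_comm]] /nonneg_sqrt[c [[c_sa _] cx c_comm]].
have xb : smul x b = smul b x by rewrite -bx smul_assoc.
have bc : smul b c = smul c b by apply: c_comm; rewrite smulNl smulNr xb.
have bb : smul b b = - smul c c by rewrite bx cx opprK.
have d0 : b - i *: c = 0.
  apply: cstar_eq0; rewrite starD starN starZi b_sa c_sa !smulE bc bb.
  by module_eq R[i] A; ring: mulii.
have bic : b = i *: c by apply/eqP; rewrite -subr_eq0 d0.
have : star b = - b by rewrite bic starZi c_sa.
rewrite b_sa => bN.
suff b0 : b = 0 by rewrite -bx b0 smul0l.
have -> : b = 2^-1%:C *: (b + b) by module_eq R[i] A; field.
by rewrite {2}bN subrr scaler0.
Qed.

(** A substitute for the equality of the nonzero spectra of [p q] and [q p].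
    Let [S = 1 + q p] and [T = 1 + p q].  From [p S = T p] and
    [S^(n+1) = S^n + q p S^n = S^n + q T^n p] the powers of [S] grow at most
    linearly.  For selfadjoint [S], [|S y|^2 <= |y| |S^2 y|] turns a vector
    expanded by [S] into exponential growth along the powers of two. *)
Lemma umul_swap p q : selfadjoint (smul q p) ->
  (forall y, nrm (umul 1 (smul p q) y) <= nrm y) ->
  forall y, nrm (umul 1 (smul q p) y) <= nrm y.
Proof.
move=> qp_sa pq_le y; pose S := umul 1 (smul q p); pose T := umul 1 (smul p q).
have S_adj n z z' : smul (star (iter n S z)) z' = smul (star z) (iter n S z').
  elim: n z => [//|n IH] z; rewrite iterSr IH /= {1 3}/S /umul.
  by rewrite starD starZ starM qp_sa conjC1 !smulE.
have S_pow_sqr n z : nrm (iter n S z) ^+ 2 <= nrm z * nrm (iter (n + n) S z).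
  rewrite -nrm_cstar S_adj iterD; apply: le_trans (nrm_smul _ _) _.
  by rewrite nrm_star.
have T_pow_le n z : nrm (iter n T z) <= nrm z.
  by elim: n => [//|n IH] /=; apply: le_trans (pq_le _) IH.
have pST n z : smul p (iter n S z) = iter n T (smul p z).
  elim: n => [//|n IH] /=; rewrite -IH /S /T /umul !smulE.
  by module_eq R[i] A; ring.
have S_pow_le n z : nrm (iter n S z) <= (1 + n%:R * (nrm q * nrm p)) * nrm z.
  elim: n => [|n IH]; first by rewrite mul0r addr0 mul1r.
  rewrite /= {1}/S /umul scale1r -natr1; apply: le_trans (nrmD _ _) _.
  have : nrm (smul (smul q p) (iter n S z)) <= nrm q * nrm p * nrm z.
    rewrite -smul_assoc pST; apply: le_trans (nrm_smul _ _) _.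
    rewrite -mulrA ler_wpM2l ?nrm_ge0 //.
    by apply: le_trans (T_pow_le _ _) (nrm_smul _ _).
  lra.
have [y0|y_gt0] := leP (nrm y) 0.
  by rewrite (nrm_le0 y0) /umul scaler0 smul0r addr0 nrm0.
rewrite -[leRHS]mul1r -ler_pdivrMr //.
apply: (@pow2_linear_growth _ _ (nrm q * nrm p)) => [|k].
  by rewrite mulr_ge0 ?nrm_ge0.
rewrite -(ler_pM2r y_gt0); apply: le_trans (S_pow_le _ _).
elim: k => [|k IH]; first by rewrite expr1 divfK ?gt_eqF.
rewrite -(ler_pM2l y_gt0) expnS mul2n -addnn.
apply: le_trans (S_pow_sqr _ _); rewrite exprD.
set r := _ ^+ (2 ^ k) in IH *.
have -> : nrm y * (r * r * nrm y) = (r * nrm y) ^+ 2 by ring.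
by rewrite ler_sqr ?nnegrE ?nrm_ge0 // mulr_ge0 ?exprn_ge0 ?divr_ge0 ?nrm_ge0.
Qed.

End PositiveCone.

Lemma positive_selfadjoint (S : starRingType) (x : S) :
  positive x -> selfadjoint x.
Proof. by case=> b ->; rewrite /selfadjoint starM starK. Qed.

Section PositiveElements.
Variables (R : realType) (A : cstarAlgType R).
Implicit Types (x y z a b c d h m p q r : A) (t : R).

Local Notation smulE := (smulE A).
Local Notation i := ('i%C : R[i]).

Lemma nonneg_star_swap c :
  nonneg (- smul (star c) c) -> nonneg (- smul c (star c)).
Proof.
move=> [_ [t t0 ct]].
have cc_sa : selfadjoint (smul c (star c)) by rewrite /selfadjoint starM starK.
split; first by rewrite /selfadjoint starN cc_sa.
exists t => // y.
have ti0 : 0 < t^-1 by rewrite invr_gt0.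
have tt : t%:C * t^-1%:C = 1 by rewrite -rmorphM /= mulfV ?gt_eqF.
have -> : umul t%:C (- - smul c (star c)) y =
    t%:C *: umul 1 (smul c (t^-1%:C *: star c)) y.
  by rewrite opprK /umul !smulE; module_eq R[i] A; ring: tt.
rewrite (nrmZ_ge0 _ (ltW t0)) ler_pM2l //; apply: umul_swap.
  by rewrite smulZr; apply: selfadjointZ.
move=> z.
have -> : umul 1 (smul (t^-1%:C *: star c) c) z =
    t^-1%:C *: umul t%:C (- - smul (star c) c) z.
  by rewrite opprK /umul !smulE; module_eq R[i] A; ring: tt.
by rewrite (nrmZ_ge0 _ (ltW ti0)) ler_pdivrMl.
Qed.

(** Twice the sum of the squares of the real and imaginary parts of [c]. *)
Lemma nonneg_starD c : nonneg (smul (star c) c + smul c (star c)).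
Proof.
pose h := c + star c; pose l := i *: (c - star c).
have h_sa : selfadjoint h by rewrite /selfadjoint starD starK addrC.
have l_sa : selfadjoint l.
  by rewrite /selfadjoint starZi starD starN starK -scalerN opprB.
have -> : smul (star c) c + smul c (star c) =
    2^-1%:C *: (smul h h + smul l l).
  rewrite /h /l !smulE; module_eq R[i] A; by field: (mulii R).
by apply: nonnegZ; [rewrite invr_gt0 | apply: nonnegD; apply: nonneg_sqr].
Qed.

(** If [- c^* c] is nonnegative then so is [- c c^*], hence also
    [c^* c], which is [c^* c + c c^*] minus [c c^*]; antisymmetry concludes. *)
Lemma cstar_nonpos_eq0 c : nonneg (- smul (star c) c) -> c = 0.
Proof.
move=> cc; apply/cstar_eq0/nonneg_antisym => //.
have -> : smul (star c) c =
    (smul (star c) c + smul c (star c)) + - smul c (star c) by rewrite addrK.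
by apply: nonnegD (nonneg_starD c) (nonneg_star_swap cc).
Qed.

(** Let [r] be the absolute value of [x = b^* b] and [m = r - x], twice the
    negative part.  Then [x m = - r m], so that [c = b m] has
    [c^* c = m x m = - r m^2 = - (rho m)^2] with [rho] the root of [r].  Hence
    [c = 0], then [x m = r m = 0], [m^2 = 0], and [x = r]. *)
Lemma positive_nonneg x : positive x -> nonneg x.
Proof.
move=> x_pos; have x_sa := positive_selfadjoint x_pos; case: x_pos => b xE.
have [r [r_nn rr r_comm]] := nonneg_sqrt (nonneg_sqr x_sa).
have [rho [[rho_sa _] rho2 rho_comm]] := nonneg_sqrt r_nn.
have r_sa := r_nn.1.
have xr : smul x r = smul r x by apply: r_comm; rewrite smul_assoc.
pose m := r - x.
have m_sa : selfadjoint m by apply: selfadjointB.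
have xm : smul x m = - smul r m.
  by rewrite /m !smulE rr xr; module_eq R[i] A; ring.
have mr : smul m r = smul r m by rewrite /m !smulE xr.
have rho_m : smul m rho = smul rho m by apply: rho_comm.
have c0 : smul b m = 0.
  apply: cstar_nonpos_eq0.
  have -> : - smul (star (smul b m)) (smul b m) =
      smul (smul rho m) (smul rho m).
    rewrite starM m_sa -smul_assoc [smul (star b) _]smul_assoc -xE xm smulNr.
    by rewrite opprK -rho2 !smul_assoc rho_m.
  by apply: nonneg_sqr; rewrite /selfadjoint starM m_sa rho_sa rho_m.
have xm0 : smul x m = 0 by rewrite xE -smul_assoc c0 smul0r.
have rm0 : smul r m = 0 by apply/eqP; rewrite -oppr_eq0 -xm xm0.
have m0 : m = 0.
  by apply: cstar_eq0; rewrite m_sa {1}/m smulDl smulNl xm0 rm0 subr0.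
suff -> : x = r by [].
by apply/esym/eqP; rewrite -subr_eq0 -/m m0.
Qed.

Lemma nonneg_positive x : nonneg x -> positive x.
Proof. by case/nonneg_sqrt=> r [[r_sa _] rr _]; exists r; rewrite r_sa rr. Qed.

Lemma positive0 : positive (0 : A).
Proof. by exists 0; rewrite smul0r. Qed.

Lemma positiveD x y : positive x -> positive y -> positive (x + y).
Proof.
by move=> /positive_nonneg x0 /positive_nonneg y0; apply/nonneg_positive/nonnegD.
Qed.

Lemma positiveZ t x : 0 <= t -> positive x -> positive (t%:C *: x).
Proof.
rewrite le_eqVlt => /orP[/eqP <- _|t0 x0].
  by rewrite scale0r; apply: positive0.
exact/nonneg_positive/nonnegZ/positive_nonneg.
Qed.

Lemma positive_antisym x : positive x -> positive (- x) -> x = 0.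
Proof. by move=> /positive_nonneg x0 /positive_nonneg; apply: nonneg_antisym. Qed.

Lemma positive_mul_bound x t :
  positive x -> 0 < t -> nrm x <= t -> mul_bound t x.
Proof.
by move=> /positive_nonneg/nonneg_sqrt[r [[r_sa _] <- _]] t0; apply: sqr_mul_bound.
Qed.

Lemma positive_closed x :
  (forall eps, 0 < eps -> exists2 x', positive x' & nrm (x - x') <= eps) ->
  positive x.
Proof.
move=> x_lim; apply: nonneg_positive; split.
  apply/eqP; rewrite -subr_eq0; apply/eqP/nrm_le0/ler_addgt0Pr => eps eps0.
  have eps2 : 0 < eps / 2 by rewrite divr_gt0.
  have [x' /positive_selfadjoint x'_sa near] := x_lim _ eps2.
  apply: le_trans (nrm_dist_trans x' _ _) _.
  by rewrite -{1}x'_sa -starN -starD nrm_star [X in _ + X]nrm_distC; lra.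
have t0 : 0 < nrm x + 1 by have := nrm_ge0 x; lra.
exists (nrm x + 1) => // y; apply/ler_addgt0Pr => eps eps0.
have y1 : 0 < nrm y + 1 by have := nrm_ge0 y; lra.
(* the bound [1] keeps the norm of the approximant below [nrm x + 1] *)
pose e := Num.min 1 (eps / (nrm y + 1)).
have e0 : 0 < e by rewrite lt_min ltr01 divr_gt0.
have [x' x'_pos near] := x_lim e e0.
have le1 : nrm (x - x') <= 1 by apply: le_trans near _; rewrite ge_min lexx.
have le2 : nrm (x - x') * (nrm y + 1) <= eps.
  by rewrite -ler_pdivlMr //; apply: le_trans near _; rewrite ge_min lexx orbT.
have bnd := positive_mul_bound x'_pos t0.
have -> : umul (nrm x + 1)%:C (- x) y =
    umul (nrm x + 1)%:C (- x') y - smul (x - x') y.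
  by rewrite /umul !smulE; module_eq R[i] A; ring.
apply: le_trans (nrmB _ _) _; apply: lerD.
  apply: bnd; have -> : x' = x - (x - x') by rewrite subKr.
  by apply: le_trans (nrmB _ _) _; rewrite lerD2l.
apply: le_trans (nrm_smul _ _) _; apply: le_trans le2.
by rewrite ler_wpM2l ?nrm_ge0 // lerDl.
Qed.

End PositiveElements.

(** * Entrywise monotone maps are convex along rays *)

(** Bisection: a point of the left half is twice as close to [b / 2] as its
    double is to [b], and symmetrically on the right; only midpoints with the
    endpoints [0] and [1] occur. *)
Lemma midpoint_closed_dense (R : realType) (P : R -> Prop) : P 0 -> P 1 ->
  (forall u v, 0 <= u <= v -> P u -> P v -> P ((u + v) / 2)) ->
  forall c eps, 0 <= c <= 1 -> 0 < eps ->
  exists2 b, P b & `|c - b| <= eps.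
Proof.
move=> P0 P1 P_mid c eps c01 eps0.
have dyadic n : forall c, 0 <= c <= 1 ->
    exists b, [/\ 0 <= b <= 1, P b & (2 ^ n)%:R * `|c - b| <= 1].
  elim: n => [|n IH] {c01}c /andP[c0 c1].
    by exists 0; rewrite lexx ler01 subr0 mul1r ger0_norm.
  have double x : (2 ^ n.+1)%:R * `|x| = (2 ^ n)%:R * `|2 * x|.
    by rewrite normrM (@ger0_norm _ 2) // expnS natrM; ring.
  have [c_le|c_gt] := leP c 2^-1.
    have [|b [/andP[b0 b1] Pb near]] := IH (2 * c); first by lra.
    exists ((0 + b) / 2); split; [lra|by apply: P_mid; rewrite ?lexx|].
    by rewrite double mulrBr add0r [2 * (b / 2)]mulrC divfK.
  have [|b [/andP[b0 b1] Pb near]] := IH (2 * c - 1); first by lra.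
  exists ((b + 1) / 2); split; [lra|by apply: P_mid; rewrite ?b0|].
  rewrite double mulrBr [2 * ((b + 1) / 2)]mulrC divfK //.
  by have -> : 2 * c - (b + 1) = 2 * c - 1 - b by ring.
have eps_inv : 0 <= eps^-1 by rewrite invr_ge0 ltW.
have [b [_ Pb near]] := dyadic (Num.bound eps^-1) c c01.
exists b => //; rewrite leNgt; apply/negP => lt_eps.
have := archi_boundP eps_inv; set n := Num.bound _ in near * => n_gt.
have : eps^-1 < (2 ^ n)%:R by apply: lt_trans n_gt _; rewrite ltr_nat ltn_expl.
rewrite -(ltr_pM2r eps0) mulVf ?gt_eqF // => big.
have : (2 ^ n)%:R * eps <= (2 ^ n)%:R * `|c - b| by rewrite ler_wpM2l ?ler0n ?ltW.
lra.
Qed.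

(** The Gram matrix of the row with entries [v j *: b], where [a = b^* b],
    padded by zero rows. *)
Lemma positive_rank1 (R : realType) (A : cstarAlgType R) (n : nat)
    (v : 'I_n.+1 -> R) (a : A) : positive a ->
  positive (\matrix_(i, j) ((v i * v j)%:C *: a)).
Proof.
case=> b ->; exists (\matrix_(k, j) (if k == 0 then (v j)%:C *: b else 0)).
apply/matrixP => i j; rewrite !mxE (bigD1 0) //= big1 => [|k /negPf k0].
  by rewrite !mxE eqxx addr0 starZr smulZl smulZr scalerA -rmorphM.
by rewrite !mxE k0 smul0r.
Qed.

Lemma positive_sum (R : realType) (A : cstarAlgType R) (n : nat)
    (F : 'I_n -> A) : (forall i, positive (F i)) -> positive (\sum_i F i).
Proof.
move=> F0; elim/big_ind: _ => //; first exact: positive0.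
by move=> x y; apply: positiveD.
Qed.

(** Pairing a positive matrix with the vector all of whose entries are one,
    which needs no unit in the algebra. *)
Lemma positive_sum_entries (R : realType) (A : cstarAlgType R) (n : nat)
    (M : 'M[A]_n) : positive M -> positive (\sum_i \sum_j M i j).
Proof.
case=> N ->.
have -> : \sum_i \sum_j smul (star N) N i j =
    \sum_k smul (star (\sum_i N k i)) (\sum_j N k j).
  transitivity (\sum_i \sum_k smul (star (N k i)) (\sum_j N k j)).
    apply: eq_bigr => i _.
    under eq_bigr => j _ do rewrite mxE.
    rewrite exchange_big; apply: eq_bigr => k _; rewrite smul_sumr.
    by apply: eq_bigr => j _; rewrite mxE.
  rewrite exchange_big; apply: eq_bigr => k _.
  by rewrite star_sum smul_suml.
by apply: positive_sum => k; exists (\sum_j N k j).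
Qed.

Section EntrywiseMonotone.
Variables (R : realType) (A B : cstarAlgType R) (Phi : A -> B).
Hypotheses (Phi_cont : continuous Phi) (Phi_mon : Smonp 2 Phi).

Lemma midpoint_convex (a : A) (u v : R) : positive a -> 0 <= u <= v ->
  positive (Phi (u%:C *: a) + Phi (v%:C *: a) -
            2%:C *: Phi (((u + v) / 2)%:C *: a)).
Proof.
move=> a_pos /andP[u0 uv].
have x0 : 0 <= (u + v) / 2 by lra.
have h0 : 0 <= (v - u) / 2 by lra.
pose s := Num.sqrt ((u + v) / 2); pose t := Num.sqrt ((v - u) / 2).
have ss : s * s = (u + v) / 2 by rewrite -expr2 sqr_sqrtr.
have tt : t * t = (v - u) / 2 by rewrite -expr2 sqr_sqrtr.
pose Y : 'M[A]_2 := \matrix_(i, j) ((s * s)%:C *: a).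
pose w (j : 'I_2) := if j == 0 then t else - t.
pose D : 'M[A]_2 := \matrix_(i, j) ((w i * w j)%:C *: a).
have Y_pos : positive Y by apply: (positive_rank1 (fun=> s)).
have D_pos : positive D by apply: positive_rank1.
have Y_sa := positive_selfadjoint Y_pos.
have D_sa := positive_selfadjoint D_pos.
(* [Y + D] has diagonal entries [v a] and off-diagonal entries [u a]. *)
have [] := Phi_mon.2 (Y + D) Y.
- by split; rewrite ?subr0 // /selfadjoint star0.
- by split=> //; [rewrite /selfadjoint starD Y_sa D_sa | rewrite addrC addKr].
move=> _ _ /positive_sum_entries.
rewrite !big_ord_recl !big_ord0 !mxE /w /= !addr0 ss !mulrNN !mulrN !mulNr tt.
rewrite -!scalerDl -!rmorphD /=.
have -> : (u + v) / 2 + (v - u) / 2 = v by field.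
have -> : (u + v) / 2 + - ((v - u) / 2) = u by field.
have half0 : 0 <= 2^-1 :> R by rewrite invr_ge0.
move=> /(positiveZ half0).
by congr positive; module_eq R[i] B; field.
Qed.

Lemma subhomogeneous (a : A) (c : R) : Phi 0 = 0 -> positive a ->
  0 <= c <= 1 -> positive (c%:C *: Phi a - Phi (c%:C *: a)).
Proof.
move=> Phi0 a_pos c01.
pose F (c : R) := c%:C *: Phi a - Phi (c%:C *: a).
have F0 : positive (F 0) by rewrite /F !scale0r Phi0 subr0; apply: positive0.
have F1 : positive (F 1) by rewrite /F !scale1r subrr; apply: positive0.
have F_mid u v : 0 <= u <= v -> positive (F u) -> positive (F v) ->
    positive (F ((u + v) / 2)).
  move=> uv Fu Fv.
  have -> : F ((u + v) / 2) = 2^-1%:C *: ((F u + F v) + (Phi (u%:C *: a) +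
      Phi (v%:C *: a) - 2%:C *: Phi (((u + v) / 2)%:C *: a))).
    by rewrite /F; module_eq R[i] B; field.
  apply: positiveZ; rewrite ?invr_ge0 //.
  by apply: positiveD; [apply: positiveD | apply: midpoint_convex].
apply: positive_closed => eps eps0.
have eps2 : 0 < eps / 2 by rewrite divr_gt0.
have /cvgrPdist_lt /(_ (eps / 2)%:C) := @Phi_cont (c%:C *: a).
rewrite ltcR => /(_ eps2) /nbhs_ballP [d' d'0 near_Phi].
have d'_real : (complex.Re d')%:C = d' by rewrite RRe_real ?gtr0_real.
set d := complex.Re d' in d'_real; have d0 : 0 < d by rewrite -ltcR d'_real.
have nA : 0 < nrm a + 1 by have := nrm_ge0 a; lra.
have nB : 0 < nrm (Phi a) + 1 by have := nrm_ge0 (Phi a); lra.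
pose e := Num.min (eps / 2 / (nrm (Phi a) + 1)) (d / (nrm a + 1)).
have e0 : 0 < e by rewrite lt_min !divr_gt0.
have [b Fb cb] := midpoint_closed_dense F0 F1 F_mid c01 e0.
exists (F b) => //.
have cb1 : `|c - b| * (nrm (Phi a) + 1) <= eps / 2.
  by rewrite -ler_pdivlMr //; apply: le_trans cb _; rewrite ge_min lexx.
have cb2 : `|c - b| * (nrm a + 1) <= d.
  by rewrite -ler_pdivlMr //; apply: le_trans cb _; rewrite ge_min lexx orbT.
have cba : nrm (c%:C *: a - b%:C *: a) < d.
  rewrite -scalerBl -rmorphB /= nrmZ.
  have [->|ne] := eqVneq `|c - b| 0; first by rewrite mul0r.
  apply: lt_le_trans cb2; rewrite ltr_pM2l ?ltrDl //.
  by rewrite lt_neqAle eq_sym ne normr_ge0.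
have : `|Phi (c%:C *: a) - Phi (b%:C *: a)| < (eps / 2)%:C.
  by apply: near_Phi; rewrite -ball_normE /= -d'_real nrmE ltcR.
rewrite nrmE ltcR => Phi_near.
have -> : c%:C *: Phi a - Phi (c%:C *: a) - F b =
    (c - b)%:C *: Phi a - (Phi (c%:C *: a) - Phi (b%:C *: a)).
  by rewrite /F; module_eq R[i] B; ring.
apply: le_trans (nrmB _ _) _; rewrite nrmZ; have := normr_ge0 (c - b); lra.
Qed.

End EntrywiseMonotone.

Unset Implicit Arguments.

Theorem theorem4p2 (R : realType) (A B : cstarAlgType R) (Phi : A -> B)
    (Phi_cont : continuous Phi) (Phi_mon : Smonp 2 Phi) :
  [<-> Phi 0 = 0;
       forall (alpha : R) (a : A), 0 < alpha <= 1 -> positive a ->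
         sale (Phi (alpha%:C *: a)) (alpha%:C *: Phi a);
       forall (alpha : R) (a : A), 1 <= alpha -> positive a ->
         sale (alpha%:C *: Phi a) (Phi (alpha%:C *: a))].
Proof.
have Phi_pos := Phi_mon.1.
have Phi_sa (c : R) (a : A) : 0 <= c -> positive a ->
    selfadjoint (c%:C *: Phi a) /\ selfadjoint (Phi (c%:C *: a)).
  by move=> c0 a_pos; split; apply: positive_selfadjoint;
    [apply: positiveZ | apply: Phi_pos; apply: positiveZ] => //; apply: Phi_pos.
tfae.
- move=> Phi0 c a /andP[c0 c1] a_pos.
  have [sa1 sa2] := Phi_sa c a (ltW c0) a_pos.
  by split=> //; apply: subhomogeneous => //; rewrite ltW.
- move=> sub c a c1 a_pos; have c0 : 0 < c by lra.
  have [sa1 sa2] := Phi_sa c a (ltW c0) a_pos; split=> //.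
  have ca_pos : positive (c%:C *: a) by apply: positiveZ (ltW c0) a_pos.
  have [||_ _] := sub c^-1 (c%:C *: a); rewrite ?invr_gt0 ?c0 ?invf_le1 //.
  have cc : c%:C * c^-1%:C = 1 by rewrite -rmorphM /= mulfV ?gt_eqF.
  rewrite scalerA mulrC cc scale1r => /(positiveZ (ltW c0)).
  by congr positive; module_eq R[i] B; ring: cc.
- move=> super; apply: positive_antisym; first exact/Phi_pos/positive0.
  have le12 : 1 <= 2 :> R by lra.
  have [_ _] := super 2 0 le12 (positive0 A); rewrite scaler0.
  by congr positive; module_eq R[i] B; ring.
Qed.
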